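(* The $(\varepsilon,I_\bullet,J_\circ)$-increasing flip graph is the Hasse diagram of a lattice: the relation $T\le T'$ defined by the existence of a directed path from $T$ to $T'$ is a lattice on the set of $(\varepsilon,I_\bullet,J_\circ)$-trees, and its cover relations are exactly the arcs of the increasing flip graph.
   Context: Fix an integer $n\ge1$ and $\varepsilon\in\{+,-\}^n$. Black vertices are $0_\bullet,\dots,n_\bullet$, white vertices $1_\circ,\dots,(n+1)_\circ$, compared through their integer indices. Let $P_\varepsilon$ be a convex $(2n+2)$-gon in $\mathbb{R}^2$ whose vertices, in strictly increasing $x$-order, are $0_\bullet,1_\circ,1_\bullet,\dots,n_\circ,n_\bullet,(n+1)_\circ$, with $k_\circ,k_\bullet$ strictly above the line through $0_\bullet$ and $(n+1)_\circ$ if $\varepsilon_k=+$ and strictly below if $\varepsilon_k=-$ ($1\le k\le n$). Let $I_\bullet\subseteq\{0_\bullet,\dots,n_\bullet\}$, $J_\circ\subseteq\{1_\circ,\dots,(n+1)_\circ\}$ be nonempty with $\min(I_\bullet)<\min(J_\circ)$ and $\max(I_\bullet)<\max(J_\circ)$. Let $G$ be the geometric graph on $I_\bullet\cup J_\circ$ with a straight edge $(i_\bullet,j_\circ)$ for each $i_\bullet\in I_\bullet,j_\circ\in J_\circ$ with $i<j$. Two edges cross if they meet at a point interior to both. An $(\varepsilon,I_\bullet,J_\circ)$-tree is an inclusion-maximal set of pairwise non-crossing edges of $G$. Trees $T,T'$ are related by a flip if $T\setminus\{(i_\bullet,j_\circ)\}=T'\setminus\{(i'_\bullet,j'_\circ)\}$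 for some $(i_\bullet,j_\circ)\in T$, $(i'_\bullet,j'_\circ)\in T'$, $T\ne T'$; the flip from $T$ to $T'$ is increasing if the slope of $(i_\bullet,j_\circ)$ is smaller than that of $(i'_\bullet,j'_\circ)$. The increasing flip graph is the directed graph on trees with an arc $T\to T'$ for each increasing flip. *)

(* Defs.v *)
From mathcomp Require Import all_boot all_order all_algebra.
From mathcomp Require Import boolp reals.

Set Implicit Arguments.
Unset Strict Implicit.
Unset Printing Implicit Defensive.

Import Order.TTheory GRing.Theory Num.Theory.
Local Open Scope ring_scope.

Section Plane.
Variable R : realType.
Implicit Types a b p : 'rV[R]_2.

Definition xcoord p : R := p ord0 ord0.
Definition ycoord p : R := p ord0 ord_max.

Definition slope a b : R := (ycoord b - ycoord a) / (xcoord b - xcoord a).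

(* The line through a and b is the graph of this affine function when
   xcoord a != xcoord b. *)
Definition line_at a b (x : R) : R := ycoord a + slope a b * (x - xcoord a).

Definition above_line a b p : Prop := line_at a b (xcoord p) < ycoord p.
Definition below_line a b p : Prop := ycoord p < line_at a b (xcoord p).

Definition in_open_segment a b p : Prop :=
  exists t : R, [/\ 0 < t, t < 1 & p = (1 - t) *: a + t *: b].

(* No point is a convex combination of the others: the points are exactly the
   vertices of their convex hull. *)
Definition convex_position m (v : 'I_m -> 'rV[R]_2) : Prop :=
  forall (i : 'I_m) (c : 'I_m -> R),
    (forall j, 0 <= c j) -> c i = 0 -> \sum_j c j = 1 ->
    \sum_j c j *: v j != v i.

End Plane.

(* The 2n+2 vertices of the polygon are numbered by increasing x-coordinate, in
   the order 0_b, 1_w, 1_b, ..., n_w, n_b, (n+1)_w (b: black, w: white). Hence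
   k_b (0 <= k <= n) has number 2k and k_w (1 <= k <= n+1) has number 2k-1. *)
Section Trees.
Variables (R : realType) (n : nat).
Variable v : 'I_(n.*2.+2) -> 'rV[R]_2.

Definition black (k : nat) : 'rV[R]_2 := v (inord k.*2).
Definition white (k : nat) : 'rV[R]_2 := v (inord k.*2.-1).

(* The sign of index k, for 1 <= k <= n, is eps at the ordinal k-1; true stands
   for + and false for -. *)
Definition is_polygon (eps : 'I_n -> bool) : Prop :=
  let side (s : bool) := if s then @above_line R else @below_line R in
  [/\ convex_position v,
      forall i j : 'I_(n.*2.+2), (i < j)%N -> xcoord (v i) < xcoord (v j) &
      forall k : 'I_n,
        side (eps k) (black 0%N) (white n.+1) (white k.+1) /\
        side (eps k) (black 0%N) (white n.+1) (black k.+1)].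

(* The pair (i, j) is the edge from i_b to j_w. *)
Definition edge : finType := ('I_n.+2 * 'I_n.+2)%type.

Definition edge_slope (e : edge) : R := slope (black e.1) (white e.2).

Definition cross (e f : edge) : Prop :=
  exists p, in_open_segment (black e.1) (white e.2) p /\
            in_open_segment (black f.1) (white f.2) p.

Definition noncrossing (T : {set edge}) : Prop :=
  forall e f, e \in T -> f \in T -> e != f -> ~ cross e f.

Variables I J : {set 'I_n.+2}.

Definition edges : {set edge} :=
  [set e | [&& e.1 \in I, e.2 \in J & (e.1 < e.2)%N]].

Definition is_tree (T : {set edge}) : bool :=
  maxset (fun S : {set edge} => (S \subset edges) && `[< noncrossing S >]) T.

Definition tree : finType := {T : {set edge} | is_tree T}.

Definition increasing_flip : rel tree := fun T T' =>
  (T != T') &&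
  [exists e in val T, [exists e' in val T',
    (val T :\ e == val T' :\ e') && (edge_slope e < edge_slope e')]].

(* connect is the reflexive-transitive closure. *)
Definition flip_le : rel tree := connect increasing_flip.

End Trees.

(* For labels at most n.+1 and A nonempty, these are the extrema of A. *)
Definition min_index n (A : {set 'I_n.+2}) : nat :=
  \big[minn/n.+1]_(a in A) (a : nat).
Definition max_index n (A : {set 'I_n.+2}) : nat := \max_(a in A) (a : nat).

(* The axioms of the latticeType interface, for the relation le. *)
Definition is_lattice (T : Type) (le : rel T) : Prop :=
  [/\ reflexive le, antisymmetric le, transitive le,
      exists meet : T -> T -> T,
        forall x y z, le x (meet y z) = le x y && le x z &
      exists join : T -> T -> T,
        forall x y z, le (join x y) z = le x z && le y z].

Definition covered_by (T : eqType) (le : rel T) (x y : T) : Prop :=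
  [/\ x != y, le x y & forall z, le x z -> le z y -> z = x \/ z = y].

(* Main.v *)
(* By convexity, two edges cross if and only if their index ranges overlap and
   the edge that starts higher ends lower; it is then the one with the smaller
   slope. This relation "below" depends only on the signs and the indices. If e
   is below x, then whatever crosses a corner, that is one of the two other
   edges on the ends of e and x, crosses e or x in the same direction.
   A tree T is the intersection of the set lower T of edges that have no edge
   of T below them with the set upper T of edges that are below no edge of T.
   By pushing a crossing to corners, the pairs (lower T, upper T) are exactly
   the concepts of the Galois connection of the relation "not below", so the
   inclusion of the sets lower T is a lattice order. If T < T', an edge of
   lower T' \ lower T crossing as few edges of T as possible crosses only one
   of them, and replacing that one is an increasing flip that stays below T'. *)
Require Import Defs.
From mathcomp Require Import all_boot all_order all_algebra.
From mathcomp Require Import boolp reals.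
From mathcomp Require Import zify ring lra.

Set Implicit Arguments.
Unset Strict Implicit.
Unset Printing Implicit Defensive.

Import Order.TTheory GRing.Theory Num.Theory.

(** * The crossing relation in terms of indices and signs *)

Section Below.
Variables (m : nat) (s : nat -> bool).
Implicit Types e f g x y t c a : 'I_m * 'I_m.

(* Here s k is true when the vertices of index k are on the upper chain. Of two
   vertices of the same colour, an edge at the one passing over the abscissa of
   the other runs above or below it according to the sign of the latter. *)
Definition lower_black i k := (i < k) && s k || (k < i) && ~~ s i.
Definition lower_white j l := (j < l) && ~~ s j || (l < j) && s l.

Definition below e f :=
  [&& e.1 < f.2, f.1 < e.2, lower_black f.1 e.1 & lower_white e.2 f.2].

Definition corner e x c := (c == (e.1, x.2)) || (c == (x.1, e.2)).

(** [lia] sees the values of [s] as independent Booleans; [pair_congr] supplies the equalities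
    forced when two indices of the same colour coincide. *)
Let sign_eq (i k : nat) : i = k -> s i = s k. Proof. by move->. Qed.

Ltac pair_congr e f :=
  pose proof (@sign_eq e.1 f.1); pose proof (@sign_eq e.2 f.2).

Lemma below_asym e f : below e f -> ~~ below f e.
Proof. by pair_congr e f; rewrite /below /lower_black /lower_white; lia. Qed.

Lemma belowxx e : below e e = false.
Proof. by rewrite /below /lower_black ltnn !andbF. Qed.

Lemma corner_valid e x c : below e x -> corner e x c -> c.1 < c.2.
Proof. by case/and4P=> ex xe _ _ /orP[] /eqP->. Qed.

(** Geometrically, the corner and the crossing point of [e] and [x] span a triangle that contains no
    other vertex, so an edge crossing the corner also crosses [e] or [x], in the same direction. In
    indices this is a finite case analysis. *)
Lemma below_corner e x c y : e.1 < e.2 -> x.1 < x.2 -> y.1 < y.2 ->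
  below e x -> corner e x c -> below y c -> below y e || below y x.
Proof.
pair_congr e x; pair_congr e y; pair_congr x y.
rewrite /below /lower_black /lower_white => ve vx vy ex.
by case/orP => /eqP-> /=; lia.
Qed.

Lemma corner_below e x c y : e.1 < e.2 -> x.1 < x.2 -> y.1 < y.2 ->
  below e x -> corner e x c -> below c y -> below e y || below x y.
Proof.
pair_congr e x; pair_congr e y; pair_congr x y.
rewrite /below /lower_black /lower_white => ve vx vy ex.
by case/orP => /eqP-> /=; lia.
Qed.

Lemma corner_uncrossed e x c : corner e x c ->
  [/\ ~~ below c e, ~~ below e c, ~~ below c x & ~~ below x c].
Proof.
by case/orP => /eqP-> /=; rewrite /below /lower_black /lower_white /= !ltnn !andbF.
Qed.

(* Increases with the height of the black end and decreases with the height of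
   the white end. *)
Definition tilt e :=
  (if s e.1 then m + e.1 else m - e.1) +
  (if s e.2 then (e.2 : nat) else m.*2 - e.2).

(** A corner trades one end of [e] for one end of [x], and each such trade changes [tilt] strictly.
    Hence crossings cannot be pushed to corners forever. *)
Lemma tilt_corner e x c : below e x -> corner e x c -> tilt x < tilt c < tilt e.
Proof.
have := ltn_ord e.1; have := ltn_ord e.2; have := ltn_ord x.1; have := ltn_ord x.2.
move=> b1 b2 b3 b4; rewrite /below /lower_black /lower_white => ex.
by case/orP => /eqP->; rewrite /tilt /=; move: ex;
  case: (s e.1); case: (s e.2); case: (s x.1); case: (s x.2) => /=; lia.
Qed.

(** Compared with [g], the corner [(t.1, g.2)] starts higher and the corner [(g.1, t.2)] ends lower,
    so either stays below [a] as soon as its range overlaps that of [a]. Comparing [t.1] with [a.2]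
    selects a corner that overlaps. The next lemma is the mirror image. *)
Lemma uncross_left t g a : t.1 < t.2 -> a.1 < a.2 -> below t g -> below g a ->
  exists2 c, corner t g c & below c a.
Proof.
move=> vt va tg ga; case: (ltnP t.1 a.2) => ta.
  exists (t.1, g.2); first by rewrite /corner eqxx.
  move: tg ga ta; pair_congr t g; pair_congr g a; pair_congr t a.
  by rewrite /below /lower_black /lower_white /=; lia.
exists (g.1, t.2); first by rewrite /corner eqxx orbT.
move: tg ga ta; pair_congr t g; pair_congr g a; pair_congr t a.
by rewrite /below /lower_black /lower_white /=; lia.
Qed.

Lemma uncross_right a g t : t.1 < t.2 -> a.1 < a.2 -> below a g -> below g t ->
  exists2 c, corner g t c & below a c.
Proof.
move=> vt va ag gt; case: (ltnP a.1 t.2) => ta.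
  exists (g.1, t.2); first by rewrite /corner eqxx.
  move: ag gt ta; pair_congr t g; pair_congr g a; pair_congr t a.
  by rewrite /below /lower_black /lower_white /=; lia.
exists (t.1, g.2); first by rewrite /corner eqxx orbT.
move: ag gt ta; pair_congr t g; pair_congr g a; pair_congr t a.
by rewrite /below /lower_black /lower_white /=; lia.
Qed.

Lemma below_corner_exists e x y : e.1 < e.2 -> x.1 < x.2 -> y.1 < y.2 ->
  below e x -> below y e -> exists2 c, corner e x c & below y c.
Proof.
move=> ve vx vy ex ye; case: (ltnP y.1 x.2) => yx.
  exists (e.1, x.2); first by rewrite /corner eqxx.
  move: ex ye yx; pair_congr e x; pair_congr e y; pair_congr x y.
  by rewrite /below /lower_black /lower_white /=; lia.
exists (x.1, e.2); first by rewrite /corner eqxx orbT.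
move: ex ye yx; pair_congr e x; pair_congr e y; pair_congr x y.
by rewrite /below /lower_black /lower_white /=; lia.
Qed.

Lemma edge_inj e f : e.1 = f.1 :> nat -> e.2 = f.2 :> nat -> e = f.
Proof. by case: e f => [? ?] [? ?] /= /ord_inj-> /ord_inj->. Qed.

(** If the black ends differ, the edge with the higher one, say [x], yields the corner [(x.1, e.2)]
    below [y]; if the white ends differ, the edge with the lower one, say [x], yields [(e.1, x.2)]
    below [y]. The signs exclude disjoint ranges. *)
Lemma below_unique e x y : e.1 < e.2 -> x.1 < x.2 -> y.1 < y.2 ->
  below e x -> below e y ->
  (forall c, corner e x c -> ~~ below c y) ->
  (forall c, corner e y c -> ~~ below c x) -> x = y.
Proof.
move=> ve vx vy ex ey Hx Hy.
have := Hx (e.1, x.2); have := Hx (x.1, e.2).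
have := Hy (e.1, y.2); have := Hy (y.1, e.2).
rewrite /corner !eqxx !orbT /= => /(_ isT) h1 /(_ isT) h2 /(_ isT) h3 /(_ isT) h4.
apply: edge_inj;
move: ex ey h1 h2 h3 h4; pair_congr e x; pair_congr e y; pair_congr x y;
  by rewrite /below /lower_black /lower_white /=; lia.
Qed.

Lemma unique_below x e f : x.1 < x.2 -> e.1 < e.2 -> f.1 < f.2 ->
  below e x -> below f x ->
  (forall c, corner e x c -> ~~ below f c) ->
  (forall c, corner f x c -> ~~ below e c) -> e = f.
Proof.
move=> vx ve vf ex fx He Hf.
have := He (e.1, x.2); have := He (x.1, e.2).
have := Hf (f.1, x.2); have := Hf (x.1, f.2).
rewrite /corner !eqxx !orbT /= => /(_ isT) h1 /(_ isT) h2 /(_ isT) h3 /(_ isT) h4.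
apply: edge_inj;
move: ex fx h1 h2 h3 h4; pair_congr e x; pair_congr f x; pair_congr e f;
  by rewrite /below /lower_black /lower_white /=; lia.
Qed.

End Below.

(** * The Galois connection of [lower] and [upper], and trees as its concepts *)

Section CombinatorialTrees.
Variables (n : nat) (s : nat -> bool) (I J : {set 'I_n.+2}).
Local Notation E := (edges I J).
Local Notation below := (below s).
Implicit Types (e f g x y t c a b : edge n) (S T A B : {set edge n}).

Lemma edge_valid e : e \in E -> e.1 < e.2.
Proof. by rewrite inE => /and3P[]. Qed.

Lemma corner_edge e x c : e \in E -> x \in E -> below e x -> corner e x c -> c \in E.
Proof.
move=> eE xE ex cx; have vc := corner_valid ex cx; move: eE xE vc.
by rewrite !inE => /and3P[e1 e2 _] /and3P[x1 x2 _]; case/orP: cx => /eqP-> /= ->;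
  rewrite ?e1 ?x1 ?e2 ?x2.
Qed.

Definition lower S := [set g in E | [forall b in S, ~~ below b g]].
Definition upper S := [set g in E | [forall a in S, ~~ below g a]].

Lemma lowerP S g :
  reflect (g \in E /\ {in S, forall b, ~~ below b g}) (g \in lower S).
Proof. by rewrite [g \in lower S]inE; apply: (iffP andP) => -[gE /forall_inP]. Qed.

Lemma upperP S g :
  reflect (g \in E /\ {in S, forall a, ~~ below g a}) (g \in upper S).
Proof. by rewrite [g \in upper S]inE; apply: (iffP andP) => -[gE /forall_inP]. Qed.

Lemma lower_edges S : lower S \subset E.
Proof. by apply/subsetP => g /lowerP[]. Qed.

Lemma upper_edges S : upper S \subset E.
Proof. by apply/subsetP => g /upperP[]. Qed.

Lemma lowerS S T : S \subset T -> lower T \subset lower S.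
Proof.
move=> /subsetP ST; apply/subsetP => g /lowerP[gE gT].
by apply/lowerP; split=> // b /ST /gT.
Qed.

Lemma upperS S T : S \subset T -> upper T \subset upper S.
Proof.
move=> /subsetP ST; apply/subsetP => g /upperP[gE gT].
by apply/upperP; split=> // b /ST /gT.
Qed.

Lemma sub_lower_upper S : S \subset E -> S \subset lower (upper S).
Proof.
move=> /subsetP SE; apply/subsetP => g gS; apply/lowerP; split; first exact: SE.
by move=> b /upperP[_ /(_ _ gS)].
Qed.

Lemma sub_upper_lower S : S \subset E -> S \subset upper (lower S).
Proof.
move=> /subsetP SE; apply/subsetP => g gS; apply/upperP; split; first exact: SE.
by move=> b /lowerP[_ /(_ _ gS)].
Qed.

Lemma lower_upper_lower S : S \subset E -> lower (upper (lower S)) = lower S.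
Proof.
move=> SE; apply/eqP; rewrite eqEsubset sub_lower_upper ?lower_edges // andbT.
exact/lowerS/sub_upper_lower.
Qed.

Definition corner_closed S := forall e x c,
  e \in S -> x \in S -> below e x -> corner e x c -> c \in S.

Lemma lower_closed S : S \subset E -> corner_closed (lower S).
Proof.
move=> /subsetP SE e x c /lowerP[eE eS] /lowerP[xE xS] ex cx.
apply/lowerP; split; first exact: corner_edge cx.
move=> b bS; have bE := SE _ bS; apply/negP => bc.
have := below_corner (edge_valid eE) (edge_valid xE) (edge_valid bE) ex cx bc.
by rewrite (negPf (eS _ bS)) (negPf (xS _ bS)).
Qed.

Lemma upper_closed S : S \subset E -> corner_closed (upper S).
Proof.
move=> /subsetP SE e x c /upperP[eE eS] /upperP[xE xS] ex cx.
apply/upperP; split; first exact: corner_edge cx.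
move=> b bS; have bE := SE _ bS; apply/negP => bc.
have := corner_below (edge_valid eE) (edge_valid xE) (edge_valid bE) ex cx bc.
by rewrite (negPf (eS _ bS)) (negPf (xS _ bS)).
Qed.

(** Take [c] of largest [tilt] among the elements of [B] below [a]. An element of [B] below [c]
    would give a corner in [B], still below [a], of larger [tilt]. The next lemma is the mirror
    image, with smallest [tilt]. *)
Lemma minimal_below B a b : B \subset E -> corner_closed B -> a \in E ->
  b \in B -> below b a ->
  exists c, [/\ c \in B, below c a & {in B, forall b', ~~ below b' c}].
Proof.
move=> /subsetP BE Bc aE bB ba.
have Pb : (b \in B) && below b a by rewrite bB.
case: (@arg_maxnP _ b (fun b => (b \in B) && below b a) (tilt s) Pb) => c.
move=> /andP[cB ca] cmax; exists c; split=> // b' b'B.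
apply/negP => b'c.
have [d dc da] :=
  uncross_left (edge_valid (BE _ b'B)) (edge_valid aE) b'c ca.
have /andP[ltcd _] := tilt_corner b'c dc.
by have := cmax d; rewrite da (Bc _ _ _ b'B cB b'c dc) => /(_ isT) /=;
  rewrite leqNgt ltcd.
Qed.

Lemma maximal_above A a b : A \subset E -> corner_closed A -> b \in E ->
  a \in A -> below b a ->
  exists c, [/\ c \in A, below b c & {in A, forall a', ~~ below c a'}].
Proof.
move=> /subsetP AE Ac bE aA ba.
have Pa : (a \in A) && below b a by rewrite aA.
case: (@arg_minnP _ a (fun a => (a \in A) && below b a) (tilt s) Pa) => c.
move=> /andP[cA bc] cmin; exists c; split=> // a' a'A.
apply/negP => ca'.
have [d dc bd] :=
  uncross_right (edge_valid (AE _ a'A)) (edge_valid bE) bc ca'.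
have /andP[_ ltdc] := tilt_corner ca' dc.
by have := cmin d; rewrite bd (Ac _ _ _ cA a'A ca' dc) => /(_ isT) /=;
  rewrite leqNgt ltdc.
Qed.

(* Being fixed by this operation encodes both that T is noncrossing and that it
   is maximal. *)
Definition ctree T := T == lower T :&: upper T.

Lemma ctreeP T : reflect [/\ T \subset E, {in T &, forall e f, ~~ below e f} &
    forall g, g \in E -> {in T, forall t, ~~ below t g} ->
      {in T, forall t, ~~ below g t} -> g \in T] (ctree T).
Proof.
apply: (iffP eqP) => [TE|[TE Tn Tm]].
  split=> [|e f|g gE gl gu]; first by rewrite TE subIset // lower_edges.
    by move=> eT; rewrite {1}TE => /setIP[/lowerP[_ /(_ _ eT)]].
  by rewrite TE; apply/setIP; split; [apply/lowerP | apply/upperP].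
apply/setP => g; apply/idP/setIP => [gT|[/lowerP[gE gl] /upperP[_ gu]]].
  have gE := subsetP TE _ gT.
  by split; [apply/lowerP | apply/upperP]; split=> // b bT; apply: Tn.
exact: Tm.
Qed.

Lemma lowerU S T : lower (S :|: T) = lower S :&: lower T.
Proof.
apply/setP => g; rewrite in_setI; apply/lowerP/andP.
  by case=> gE gST; split; apply/lowerP; split=> // b bS; apply: gST; rewrite inE bS ?orbT.
by case=> /lowerP[gE gS] /lowerP[_ gT]; split=> // b /setUP[/gS|/gT].
Qed.

Lemma upperU S T : upper (S :|: T) = upper S :&: upper T.
Proof.
apply/setP => g; rewrite in_setI; apply/upperP/andP.
  by case=> gE gST; split; apply/upperP; split=> // b bS; apply: gST; rewrite inE bS ?orbT.
by case=> /upperP[gE gS] /upperP[_ gT]; split=> // b /setUP[/gS|/gT].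
Qed.

Lemma ctree_edges T : ctree T -> T \subset E. Proof. by case/ctreeP. Qed.

Lemma ctree_lower T : ctree T -> T \subset lower T.
Proof. by move/eqP=> {1}->; rewrite subsetIl. Qed.

Lemma ctree_upper T : ctree T -> T \subset upper T.
Proof. by move/eqP=> {1}->; rewrite subsetIr. Qed.

(** If an element of [upper T] is below [a], so is one that has nothing of [upper T], hence nothing
    of [T], below it. Such an edge crosses no edge of [T], so it lies in [T] by maximality, and [a]
    is not in [lower T]. *)
Lemma lower_upper T : ctree T -> lower (upper T) = lower T.
Proof.
move=> tT; have TE := ctree_edges tT.
apply/eqP; rewrite eqEsubset lowerS ?ctree_upper //=.
apply/subsetP => a /lowerP[aE aT]; apply/lowerP; split=> // b bT; apply/negP => ba.
have [c [cT ca cmin]] :=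
  minimal_below (upper_edges T) (upper_closed TE) aE bT ba.
suff : c \in T by move/aT; rewrite ca.
case/upperP: cT => cE cT; case/ctreeP: (tT) => _ _; apply=> //.
by move=> t /(subsetP (ctree_upper tT)) /cmin.
Qed.

Lemma upper_lower T : ctree T -> upper (lower T) = upper T.
Proof.
move=> tT; have TE := ctree_edges tT.
apply/eqP; rewrite eqEsubset upperS ?ctree_lower //=.
apply/subsetP => b /upperP[bE bT]; apply/upperP; split=> // a aT; apply/negP => ba.
have [c [cT ca cmax]] :=
  maximal_above (lower_edges T) (lower_closed TE) bE aT ba.
suff : c \in T by move/bT; rewrite ca.
case/lowerP: cT => cE cT; case/ctreeP: (tT) => _ _; apply=> //.
by move=> t /(subsetP (ctree_lower tT)) /cmax.
Qed.

(** The intersection of the two halves of the concept whose lower half is [lower S]. *)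
Definition tree_of S := lower S :&: upper (lower S).

(** A crossing with one half of the concept can be pushed to an extremal edge of that half, which
    then belongs to the other half as well. So the intersection has the same [lower] and [upper]
    sets as the whole halves. *)
Lemma tree_ofP S : S \subset E -> ctree (tree_of S) /\ lower (tree_of S) = lower S.
Proof.
move=> SE; set T := tree_of S; have AE := lower_edges S.
have lT : lower T = lower S.
  apply/eqP; rewrite eqEsubset andbC -{1}(lower_upper_lower SE).
  rewrite (lowerS (subsetIr _ _)) /=.
  apply/subsetP => g /lowerP[gE gT]; rewrite -(lower_upper_lower SE).
  apply/lowerP; split=> // b bB; apply/negP => bg.
  have [c [cB cg cmin]] :=
    minimal_below (upper_edges _) (upper_closed AE) gE bB bg.
  suff : c \in T by move/gT; rewrite cg.
  apply/setIP; split=> //; rewrite -(lower_upper_lower SE); apply/lowerP; split=> //.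
  exact: (subsetP (upper_edges _) _ cB).
have uT : upper T = upper (lower S).
  apply/eqP; rewrite eqEsubset andbC (upperS (subsetIl _ _)) /=.
  apply/subsetP => g /upperP[gE gT].
  apply/upperP; split=> // a aA; apply/negP => ga.
  have [c [cA gc cmax]] :=
    maximal_above (lower_edges _) (lower_closed SE) gE aA ga.
  suff : c \in T by move/gT; rewrite gc.
  apply/setIP; split=> //.
  by apply/upperP; split=> //; apply: (subsetP AE _ cA).
by split=> //; rewrite /ctree lT uT.
Qed.

(** Restates the order as reverse inclusion of [upper] sets, on which joins become intersections. *)
Lemma lower_upper_sub S T : S \subset E -> ctree T ->
  (lower (upper S) \subset lower T) = (upper T \subset upper S).
Proof.
move=> SE tT; apply/idP/idP => [le|le]; last first.
  by rewrite -(lower_upper tT); apply: lowerS.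
rewrite -(upper_lower tT); apply: subset_trans (upperS le) _.
exact/upperS/sub_lower_upper.
Qed.

Lemma sub_lower_le T T' : ctree T -> ctree T' ->
  T \subset lower T' -> lower T \subset lower T'.
Proof.
move=> tT tT' TT'; rewrite -(lower_upper tT) -(lower_upper tT').
by apply: lowerS; rewrite -(upper_lower tT'); apply: upperS.
Qed.

Lemma lower_inj T T' : ctree T -> ctree T' -> lower T = lower T' -> T = T'.
Proof.
move=> tT tT' eqT; rewrite (eqP tT) (eqP tT') -(upper_lower tT) -(upper_lower tT').
by rewrite eqT.
Qed.

(** * Exchange of one edge of a tree *)

Definition crosses e f := below e f || below f e.

Definition exchangeable T e x := [/\ e \in T, x \in E &
  {in T, forall t, t != e -> ~~ crosses t x}].

(** An edge of [T] crossing the corner would cross [e] or [x]. The first is impossible inside [T];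
    the second leaves only [e], which shares an end with the corner. Maximality of [T] then
    applies. *)
Lemma exchangeable_corner T e x c : ctree T -> exchangeable T e x ->
  below e x -> corner e x c -> c \in T :\ e.
Proof.
move=> tT [eT xE xT] ex cx; have TE := subsetP (ctree_edges tT).
have [ce ec cx' xc] := corner_uncrossed s cx.
have cE : c \in E by exact: corner_edge (TE _ eT) xE ex cx.
case/ctreeP: (tT) => _ Tn Tm.
rewrite !inE; apply/andP; split; first by apply: contraNneq cx' => ->.
have bx t : t \in T -> t != e -> ~~ below t x /\ ~~ below x t.
  by move=> tT' te; apply/andP; rewrite -negb_or xT.
apply: Tm => // t tT'; apply/negP => tc; have vt := edge_valid (TE _ tT');
  have [te|te] := eqVneq t e;
  try by move: tc; rewrite te ?(negPf ec) ?(negPf ce).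
- have := below_corner (edge_valid (TE _ eT)) (edge_valid xE) vt ex cx tc.
  by rewrite (negPf (Tn _ _ tT' eT)) /= (negPf (bx _ tT' te).1).
- have := corner_below (edge_valid (TE _ eT)) (edge_valid xE) vt ex cx tc.
  by rewrite (negPf (Tn _ _ eT tT')) /= (negPf (bx _ tT' te).2).
Qed.

(** The corners of [e] and [x] lie in [T] without [e], so [y] does not cross them, and
    conversely. *)
Lemma exchangeable_unique T e x y : ctree T ->
  exchangeable T e x -> exchangeable T e y -> below e x -> below e y -> x = y.
Proof.
move=> tT Hx Hy ex ey; have [eT xE xT] := Hx; have [_ yE yT] := Hy.
have eE := subsetP (ctree_edges tT) _ eT.
apply: (below_unique (edge_valid eE) _ _ ex ey); try exact: edge_valid.
  move=> c /(exchangeable_corner tT Hx ex) /setD1P[ce cT].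
  by have := yT c cT ce; rewrite negb_or => /andP[].
move=> c /(exchangeable_corner tT Hy ey) /setD1P[ce cT].
by have := xT c cT ce; rewrite negb_or => /andP[].
Qed.

(** For maximality, let [y] cross nothing of the new set. If [e] is below [y], then [y] is [x] by
    uniqueness. If [y] is below [e], it is also below a corner of [e] and [x], which belongs to the
    new set. Otherwise [y] lies in [T] by maximality of [T]. *)
Lemma exchange_tree T e x : ctree T -> exchangeable T e x -> below e x ->
  ctree (x |: T :\ e).
Proof.
move=> tT Hx ex; have [eT xE xT] := Hx; have [TE Tn Tm] := ctreeP _ tT.
have bx t : t \in T :\ e -> ~~ below t x /\ ~~ below x t.
  by case/setD1P=> te tT'; apply/andP; rewrite -negb_or xT.
apply/ctreeP; split=> [|f g|y yE yl yu].
- apply/subsetP => f /setU1P[->//|/setD1P[_]]; exact: (subsetP TE).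
- case/setU1P=> [->|fT] /setU1P[->|gT]; rewrite ?belowxx //.
  + by case: (bx g gT).
  + by case: (bx f fT).
  + by apply: Tn; [case/setD1P: fT | case/setD1P: gT].
have nc t : t \in T -> t != e -> ~~ crosses t y.
  move=> tT' te; have tT'' : t \in x |: T :\ e by rewrite !inE te tT' orbT.
  by rewrite negb_or yl // yu.
have [ey|ney] := boolP (below e y).
  by rewrite (exchangeable_unique tT Hx _ ex ey) ?setU11.
have [ye|nye] := boolP (below y e).
  have [c cc yc] := below_corner_exists (edge_valid (subsetP TE _ eT)) (edge_valid xE)
    (edge_valid yE) ex ye.
  have cT := exchangeable_corner tT Hx ex cc.
  by have := yu c (setU1r _ cT); rewrite yc.
have yT : y \in T.
  apply: Tm => // t tT'; have [->//|te] := eqVneq t e;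
  by have := nc t tT' te; rewrite negb_or => /andP[].
rewrite !inE yT andbT; apply/orP; right.
by apply: contraTneq ex => <-; rewrite yu ?setU11.
Qed.

Lemma exchange_le T e x : ctree T -> exchangeable T e x -> below e x ->
  lower T \subset lower (x |: T :\ e).
Proof.
move=> tT [eT xE xT] ex; rewrite -(lower_upper tT); apply: lowerS.
apply/subsetP => t /setU1P[->|/setD1P[_]]; last exact: (subsetP (ctree_upper tT)).
apply/upperP; split=> // t' tT'; have [->|te] := eqVneq t' e; first exact: below_asym.
by have := xT t' tT' te; rewrite negb_or => /andP[].
Qed.

Lemma ctree_max T T' : ctree T -> ctree T' -> T \subset T' -> T = T'.
Proof.
case/ctreeP=> _ _ Tm /ctreeP[TE' Tn' _] /subsetP TT'.
apply/eqP; rewrite eqEsubset; apply/andP; split; first exact/subsetP.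
by apply/subsetP => g gT'; apply: Tm => [|t /TT' tT'|t /TT' tT'];
  [apply: (subsetP TE') | apply: Tn' | apply: Tn'].
Qed.

(** The edges of [T] other than [e] lie in both trees, hence in [S], which is between them. Any edge
    of [S] outside [T] therefore crosses [e] alone; since [e] lies in [lower S], it has [e] below it
    and must be [x]. *)
Lemma exchange_cover T e x S : ctree T -> exchangeable T e x -> below e x ->
  ctree S -> lower T \subset lower S -> lower S \subset lower (x |: T :\ e) ->
  S = T \/ S = x |: T :\ e.
Proof.
move=> tT Hx ex tS TS ST'; have [eT xE xT] := Hx; have [TE _ Tm] := ctreeP _ tT.
have tT' := exchange_tree tT Hx ex; set T' := x |: T :\ e in ST' tT' *.
have [SE Sn _] := ctreeP _ tS.
have TeS : T :\ e \subset S.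
  apply/subsetP => t tTe; rewrite (eqP tS); apply/setIP; split.
    by apply/(subsetP TS)/(subsetP (ctree_lower tT)); case/setD1P: tTe.
  have tuT' := subsetP (ctree_upper tT') _ (setU1r x tTe).
  rewrite -(upper_lower tS); apply: (subsetP (upperS ST')).
  by rewrite (upper_lower tT').
have [ST|/subsetPn[g gS gT]] := boolP (S \subset T).
  by left; apply: ctree_max.
right; suff xS : x \in S.
  by apply/esym/ctree_max => //; apply/subsetP => t /setU1P[->//|/(subsetP TeS)].
have ng t : t \in T -> t != e -> ~~ crosses t g.
  move=> tT1 te; have tS1 : t \in S by apply: (subsetP TeS); rewrite !inE te.
  by rewrite negb_or !Sn.
have gE := subsetP SE _ gS.
have nge : ~~ below g e.
  have /(subsetP TS)/lowerP[_] := subsetP (ctree_lower tT) _ eT; exact.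
suff eg : below e g by rewrite (exchangeable_unique tT Hx _ ex eg).
apply: contraNT gT => neg; apply: Tm => // t tT1; have [->//|te] := eqVneq t e;
  by have := ng t tT1 te; rewrite negb_or => /andP[].
Qed.

(** The minimal choice of [x] puts its corners with the edges of [T] that cross it into [lower T].
    This forces all these crossings to have the same direction and to come from a single edge. *)
Lemma exchange_between T T' : ctree T -> ctree T' -> T != T' ->
  lower T \subset lower T' ->
  exists e x, [/\ exchangeable T e x, below e x &
    lower (x |: T :\ e) \subset lower T'].
Proof.
move=> tT tT' neqT leT; have [TE Tn Tm] := ctreeP _ tT.
have TE' := subsetP TE.
have T'E := ctree_edges tT'.
have [x0 x0P] : exists x, x \in lower T' :\: lower T.
  apply/set0Pn; rewrite setD_eq0; apply: contra neqT => geT.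
  by apply/eqP/lower_inj => //; apply/eqP; rewrite eqEsubset leT.
pose cr x := [set t in T | crosses t x].
case: (@arg_minnP _ x0 (mem (lower T' :\: lower T)) (fun x => #|cr x|) x0P) => x.
move=> /setDP[xT' xT] xmin.
have xE := subsetP (lower_edges _) _ xT'.
have [e eT ex] : exists2 e, e \in T & below e x.
  apply/exists_inP; apply: contraNT xT => /exists_inPn nx.
  by apply/lowerP; split.
(* Such a corner is crossed by fewer edges of T than x. *)
have cornerT t c : t \in T ->
    below t x && corner t x c || below x t && corner x t c -> c \in lower T.
  move=> tT1 H; apply: contraT => cT.
  have txT' : t \in lower T' by apply/(subsetP leT)/(subsetP (ctree_lower tT)).
  have cT' : c \in lower T'.
    by case/orP: H => /andP[? ?]; [apply: (@lower_closed _ T'E t x c)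
                                 | apply: (@lower_closed _ T'E x t c)].
  have cD : c \in lower T' :\: lower T by apply/setDP.
  have := xmin c cD; rewrite leqNgt => /negP[].
  have vt := edge_valid (TE' _ tT1); have vx := edge_valid xE.
  apply: proper_card; apply/properP; split.
    apply/subsetP => y; rewrite !inE => /andP[yT]; rewrite yT /=.
    have vy := edge_valid (TE' _ yT).
    have nyt := negPf (Tn _ _ yT tT1); have nty := negPf (Tn _ _ tT1 yT).
    case/orP: H => /andP[tx cc] /orP[] /=; rewrite /crosses.
    + by move/(below_corner vt vx vy tx cc); rewrite nyt /= => ->.
    + by move/(corner_below vt vx vy tx cc); rewrite nty /= orbC => ->.
    + by move/(below_corner vx vt vy tx cc); rewrite nyt orbF => ->.
    + by move/(corner_below vx vt vy tx cc); rewrite nty orbF orbC => ->.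
  exists t; first by rewrite inE tT1 /crosses; case/orP: H => /andP[->]; rewrite ?orbT.
  rewrite inE tT1 /= negb_or; apply/andP.
  by case/orP: H => /andP[_ /(corner_uncrossed s)[]].
(* With [e] below [x] and [x] below [t], pushing would put [e] below a corner of [x] and [t], which
   lies in [lower T]. *)
have noxt t : t \in T -> ~~ below x t.
  move=> tT1; apply/negP => xt; have vt := edge_valid (TE' _ tT1).
  have [c cc ec] := uncross_right vt (edge_valid (TE' _ eT)) ex xt.
  have /lowerP[_ /(_ _ eT)] : c \in lower T by apply: (cornerT t); rewrite ?xt ?cc ?orbT.
  by rewrite ec.
(* Two edges of [T] below [x] coincide, since neither is below a corner of [x] with the other. *)
have Hx : exchangeable T e x.
  split=> // f fT; apply: contraNN; rewrite /crosses (negPf (noxt _ fT)) orbF => fx.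
  have corner_nc g h c : g \in T -> h \in T -> below g x -> corner g x c ->
      ~~ below h c.
    move=> gT hT gx cc.
    have /lowerP[_] : c \in lower T by apply: (cornerT g); rewrite ?gx ?cc.
    exact.
  apply/eqP; apply: (unique_below (edge_valid xE) _ _ fx ex);
    try exact/edge_valid/TE'.
  + by move=> c; apply: corner_nc.
  + by move=> c; apply: corner_nc.
exists e, x; split=> //; apply: sub_lower_le => //; first exact: exchange_tree.
apply/subsetP => t /setU1P[->//|/setD1P[_ tT1]].
exact/(subsetP leT)/(subsetP (ctree_lower tT)).
Qed.

End CombinatorialTrees.

(** * Segments, lines and points in convex position *)

Section Lines.
Local Open Scope ring_scope.
Variable R : realType.
Implicit Types a b p : 'rV[R]_2.

Lemma point_eq p q : xcoord p = xcoord q -> ycoord p = ycoord q -> p = q.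
Proof.
move=> px py; apply/rowP => i; case: i => [[|[|//]] i].
- by rewrite (_ : Ordinal i = ord0) //; apply: val_inj.
- by rewrite (_ : Ordinal i = ord_max) //; apply: val_inj.
Qed.

Lemma line_atE a b x y :
  line_at a b y = line_at a b x + slope a b * (y - x).
Proof. by rewrite /line_at; ring. Qed.

Lemma line_at_left a b : line_at a b (xcoord a) = ycoord a.
Proof. by rewrite /line_at subrr mulr0 addr0. Qed.

Lemma line_at_right a b : xcoord a < xcoord b -> line_at a b (xcoord b) = ycoord b.
Proof. by move=> ab; rewrite /line_at /slope; field; lra. Qed.

Lemma line_at_convex a b (t : R) : xcoord a < xcoord b ->
  line_at a b ((1 - t) * xcoord a + t * xcoord b) =
  (1 - t) * ycoord a + t * ycoord b.
Proof. by move=> ab; rewrite /line_at /slope; field; lra. Qed.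

Lemma convex_param (x y z : R) : x < y -> y < z ->
  exists t : R, [/\ 0 < t, t < 1 & y = (1 - t) * x + t * z].
Proof.
move=> xy yz; have xz : 0 < z - x by lra.
exists ((y - x) / (z - x)); split.
- by apply: divr_gt0 => //; lra.
- by rewrite ltr_pdivrMr // mul1r; lra.
- by field; lra.
Qed.

Lemma in_open_segmentP a b p : xcoord a < xcoord b ->
  in_open_segment a b p <->
  [/\ xcoord a < xcoord p, xcoord p < xcoord b &
      ycoord p = line_at a b (xcoord p)].
Proof.
move=> ab; split=> [[t [t0 t1 ->]]|[ap pb py]].
  have -> : xcoord ((1 - t) *: a + t *: b) = (1 - t) * xcoord a + t * xcoord b.
    by rewrite /xcoord !mxE.
  rewrite line_at_convex //; split; [nra|nra|].
  by rewrite /ycoord !mxE.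
have [t [t0 t1 xt]] := convex_param ap pb.
exists t; split=> //; apply: point_eq; first by rewrite xt /xcoord !mxE.
by rewrite py xt line_at_convex // /ycoord !mxE.
Qed.

Lemma convex_position_hull4 m (v : 'I_m -> 'rV[R]_2) (k p q a b : 'I_m)
    (c1 c2 c3 c4 : R) :
  convex_position v -> p != k -> q != k -> a != k -> b != k ->
  0 <= c1 -> 0 <= c2 -> 0 <= c3 -> 0 <= c4 -> c1 + c2 + c3 + c4 = 1 ->
  c1 *: v p + c2 *: v q + c3 *: v a + c4 *: v b != v k.
Proof.
move=> cv pk qk ak bk h1 h2 h3 h4 sum1.
(* The indices [p], [q], [a] and [b] may coincide, so the coefficients of equal indices are
   added. *)
pose c j : R := c1 *+ (j == p) + c2 *+ (j == q) + c3 *+ (j == a) + c4 *+ (j == b).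
have sum_at (r : 'I_m) (d : R) : \sum_j d *+ (j == r) = d.
  by rewrite (bigD1 r) //= eqxx big1 ?addr0 // => j /negPf->.
have sumv_at (r : 'I_m) (d : R) : \sum_j (d *+ (j == r)) *: v j = d *: v r.
  by rewrite (bigD1 r) //= eqxx big1 ?addr0 // => j /negPf->; rewrite scale0r.
have <- : \sum_j c j *: v j = c1 *: v p + c2 *: v q + c3 *: v a + c4 *: v b.
  rewrite -(sumv_at p) -(sumv_at q) -(sumv_at a) -(sumv_at b) -!big_split /=.
  by apply: eq_bigr => j _; rewrite -!scalerDl.
apply: cv.
- by move=> j; rewrite !addr_ge0 ?mulrn_wge0.
- by rewrite /c !(eq_sym k) (negPf pk) (negPf qk) (negPf ak) (negPf bk) !addr0.
- by rewrite /c !big_split /= !sum_at.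
Qed.

(* Otherwise the vertex k would be a convex combination of p, q, a and b. *)
Lemma convex_position_chords m (v : 'I_m -> 'rV[R]_2) (k p q a b : 'I_m) (w : R) :
  convex_position v ->
  xcoord (v p) < xcoord (v k) < xcoord (v q) ->
  xcoord (v a) < xcoord (v k) < xcoord (v b) ->
  0 <= w <= 1 ->
  ycoord (v k) = (1 - w) * line_at (v p) (v q) (xcoord (v k)) +
                 w * line_at (v a) (v b) (xcoord (v k)) -> False.
Proof.
move=> cv /andP[pk kq] /andP[ak kb] /andP[w0 w1] yk.
have [u [u0 u1 xu]] := convex_param pk kq.
have [t [t0 t1 xt]] := convex_param ak kb.
have ltk (i : 'I_m) : xcoord (v i) < xcoord (v k) -> i != k.
  by apply: contraTneq => ->; rewrite ltxx.
have gtk (i : 'I_m) : xcoord (v k) < xcoord (v i) -> i != k.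
  by apply: contraTneq => ->; rewrite ltxx.
have /eqP[] := convex_position_hull4
  (c1 := (1 - w) * (1 - u)) (c2 := (1 - w) * u) (c3 := w * (1 - t)) (c4 := w * t) cv (ltk p pk) (gtk q kq)
  (ltk a ak) (gtk b kb)
  ltac:(nra) ltac:(nra) ltac:(nra) ltac:(nra) ltac:(ring).
move: yk; rewrite {1}xu line_at_convex ?(lt_trans pk) //.
rewrite {1}xt line_at_convex ?(lt_trans ak) // => yk.
apply: point_eq; last by rewrite yk /ycoord !mxE; ring.
transitivity ((1 - w) * xcoord (v k) + w * xcoord (v k)); last by ring.
by rewrite {1}xu xt /xcoord !mxE; ring.
Qed.

(** If [v k] were on different sides of the two chords, or on the second one, its ordinate would lie
    between their heights [y0] and [y1], with weight [(y - y0) / (y1 - y0)], making it a convex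
    combination of other vertices. *)
Lemma convex_position_side m (v : 'I_m -> 'rV[R]_2) (k p q a b : 'I_m) :
  convex_position v ->
  xcoord (v p) < xcoord (v k) < xcoord (v q) ->
  xcoord (v a) < xcoord (v k) < xcoord (v b) ->
  (above_line (v p) (v q) (v k) -> above_line (v a) (v b) (v k)) /\
  (below_line (v p) (v q) (v k) -> below_line (v a) (v b) (v k)).
Proof.
move=> cv pkq akb; rewrite /above_line /below_line.
have := convex_position_chords cv pkq akb.
set y0 := line_at (v p) _ _; set y1 := line_at (v a) _ _; set y := ycoord _ => H.
have {}H : y0 != y1 -> 0 <= (y - y0) / (y1 - y0) <= 1 -> False.
  by move=> neq w01; apply: (H _ w01); field; rewrite subr_eq0 eq_sym.
split=> y0y; rewrite ltNge; apply/negP => y1y; apply: H.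
- by apply/eqP; lra.
- have d0 : 0 < y1 - y0 by lra.
  by rewrite divr_ge0 ?ler_pdivrMr // ?mul1r; lra.
- by apply/eqP; lra.
- have d0 : 0 < y0 - y1 by lra.
  rewrite -[X in X / _]opprB -[X in _ / X]opprB invrN mulrNN.
  by rewrite divr_ge0 ?ler_pdivrMr // ?mul1r; lra.
Qed.

End Lines.

(** * Crossings and slopes of polygon edges, read off from signs and indices *)

Section Polygon.
Local Open Scope ring_scope.
Variables (R : realType) (n : nat) (eps : 'I_n -> bool).
Variable v : 'I_(n.*2.+2) -> 'rV[R]_2.
Hypothesis v_polygon : is_polygon v eps.

(** [eps] is indexed from 0, hence the shift. The larger of two distinct black indices and the
    smaller of two distinct white ones lie between 1 and [n], so comparing ends reads values of
    [eps]. *)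
Definition sign (k : nat) := [exists i : 'I_n, (i.+1 == k) && eps i].

Local Notation black := (black v).
Local Notation white := (white v).

Lemma sign_ord (i : 'I_n) : sign i.+1 = eps i.
Proof.
apply/existsP/idP => [[j /andP[/eqP[ji]]]|ei]; last by exists i; rewrite eqxx.
by rewrite (val_inj ji).
Qed.

Lemma vertex_lt (k l : nat) : (k < l)%N -> (l < n.*2.+2)%N ->
  xcoord (v (inord k)) < xcoord (v (inord l)).
Proof.
by move=> kl ln; case: v_polygon => _ H _; apply: H; rewrite !inordK //; lia.
Qed.

(* The number h is that of k_b or of k_w; the chord joins the vertices numbered
   l and r. *)
Lemma vertex_side (k h l r : nat) : (0 < k <= n)%N -> h \in [:: k.*2; k.*2.-1] ->
  (l < h < r)%N -> (r < n.*2.+2)%N ->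
  if sign k then above_line (v (inord l)) (v (inord r)) (v (inord h))
  else below_line (v (inord l)) (v (inord r)) (v (inord h)).
Proof.
case: k => // k /= kn hk /andP[lh hr] rn.
have [cv _ /(_ (Ordinal kn)) /=] := v_polygon; rewrite -sign_ord /=.
have h1 : (0 < h)%N by lia.
(* The sign is given relative to the chord from vertex 0 to vertex 2n+1; convexity transfers it to
   the chord from [l] to [r]. *)
have [up down] := @convex_position_side _ _ v (inord h) (inord 0)
  (inord n.+1.*2.-1) (inord l) (inord r) cv
  ltac:(rewrite !vertex_lt //; lia) ltac:(rewrite !vertex_lt //; lia).
by move: hk; rewrite !inE; case: (sign k.+1) => /orP[]/eqP hE [w b];
  [apply: up|apply: up|apply: down|apply: down]; rewrite hE.
Qed.

Definition edge_line (e : edge n) := line_at (black e.1) (white e.2).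

(** Excludes the labels that name no vertex: [black n.+1] is out of range and [white 0] would be the
    vertex numbered 0. *)
Definition proper_edge (e : edge n) :=
  [&& (e.1 < e.2)%N, (e.1 <= n)%N & (0 < e.2)%N].

Lemma black_white_lt (i j : nat) : (i < j)%N -> (j <= n.+1)%N ->
  xcoord (black i) < xcoord (white j).
Proof. by move=> ij jn; apply: vertex_lt; lia. Qed.

Lemma edge_lt e : proper_edge e -> xcoord (black e.1) < xcoord (white e.2).
Proof. by case/and3P=> ? ? ?; apply: black_white_lt => //; rewrite -ltnS. Qed.

Definition overlap (e f : edge n) := (e.1 < f.2)%N && (f.1 < e.2)%N.

Definition left_end (e f : edge n) := Num.max (xcoord (black e.1)) (xcoord (black f.1)).
Definition right_end (e f : edge n) := Num.min (xcoord (white e.2)) (xcoord (white f.2)).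

Lemma right_endC e f : right_end e f = right_end f e. Proof. exact: minC. Qed.

Lemma left_right_end e f : proper_edge e -> proper_edge f -> overlap e f ->
  left_end e f < right_end e f.
Proof.
move=> pe pf /andP[ef fe]; have e2 := ltn_ord e.2; have f2 := ltn_ord f.2.
by rewrite /left_end /right_end lt_min !gt_max !edge_lt ?black_white_lt.
Qed.

(** The common range starts at the later black end, which lies on its own edge and on the side of
    the other edge given by its sign. Dually, the range ends at the earlier white end. *)
Lemma lower_black_line e f : proper_edge e -> proper_edge f -> overlap e f ->
  lower_black sign f.1 e.1 ->
  edge_line f (left_end e f) < edge_line e (left_end e f).
Proof.
move=> pe pf /andP[ef fe]; have e2n := ltn_ord e.2; have f2n := ltn_ord f.2.
have [pe' pf'] := (pe, pf); rewrite /proper_edge in pe' pf'.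
rewrite /left_end => /orP[/andP[lt se]|/andP[lt sf]].
  rewrite max_l; last by apply/ltW/vertex_lt; lia.
  have := @vertex_side e.1 e.1.*2 f.1.*2 f.2.*2.-1 ltac:(lia).
  rewrite se inE eqxx => /(_ isT ltac:(lia) ltac:(lia)).
  by rewrite /edge_line line_at_left.
rewrite max_r; last by apply/ltW/vertex_lt; lia.
have := @vertex_side f.1 f.1.*2 e.1.*2 e.2.*2.-1 ltac:(lia).
rewrite (negPf sf) inE eqxx => /(_ isT ltac:(lia) ltac:(lia)).
by rewrite /edge_line line_at_left.
Qed.

Lemma lower_white_line e f : proper_edge e -> proper_edge f -> overlap e f ->
  lower_white sign e.2 f.2 ->
  edge_line e (right_end e f) < edge_line f (right_end e f).
Proof.
move=> pe pf /andP[ef fe]; have e2n := ltn_ord e.2; have f2n := ltn_ord f.2.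
have [pe' pf'] := (pe, pf); rewrite /proper_edge in pe' pf'.
rewrite /right_end => /orP[/andP[lt se]|/andP[lt sf]].
  rewrite min_l; last by apply/ltW/vertex_lt; lia.
  have := @vertex_side e.2 e.2.*2.-1 f.1.*2 f.2.*2.-1 ltac:(lia).
  rewrite (negPf se) !inE eqxx orbT => /(_ isT ltac:(lia) ltac:(lia)).
  by rewrite /edge_line line_at_right ?edge_lt.
rewrite min_r; last by apply/ltW/vertex_lt; lia.
have := @vertex_side f.2 f.2.*2.-1 e.1.*2 e.2.*2.-1 ltac:(lia).
rewrite sf !inE eqxx orbT => /(_ isT ltac:(lia) ltac:(lia)).
by rewrite /edge_line line_at_right ?edge_lt.
Qed.

Lemma edge_line_convex e (t x y : R) :
  edge_line e ((1 - t) * x + t * y) = (1 - t) * edge_line e x + t * edge_line e y.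
Proof. by rewrite /edge_line /line_at; ring. Qed.

(** The line of [e] minus that of [f] is positive at the left end of the common range and negative
    at the right end. *)
Lemma below_slope e f : proper_edge e -> proper_edge f -> below sign e f ->
  edge_slope v e < edge_slope v f.
Proof.
move=> pe pf /and4P[ef fe lb lw]; have ov : overlap e f by rewrite /overlap ef.
have := left_right_end pe pf ov.
have := lower_black_line pe pf ov lb; have := lower_white_line pe pf ov lw.
set x := left_end e f; set y := right_end e f.
rewrite {1}/edge_line (line_atE _ _ x) [X in _ < X](line_atE _ _ x).
rewrite -/(edge_line e x) -/(edge_line f x) -/(edge_slope v e) -/(edge_slope v f).
by move=> h1 h2 xy; rewrite ltNge; apply/negP => h3; nra.
Qed.

Lemma crossP e f : proper_edge e -> proper_edge f ->
  cross v e f <-> exists x, [/\ left_end e f < x, x < right_end e f &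
    edge_line e x = edge_line f x].
Proof.
move=> pe pf; rewrite /left_end /right_end; split.
  case=> p [/(in_open_segmentP _ (edge_lt pe))[e1 e2 e3]].
  case/(in_open_segmentP _ (edge_lt pf)) => f1 f2 f3.
  by exists (xcoord p); rewrite gt_max lt_min e1 e2 f1 f2 /edge_line -e3 -f3.
case=> x []; rewrite gt_max lt_min => /andP[e1 f1] /andP[e2 f2] ef.
pose p : 'rV[R]_2 := \row_i (if i == ord0 then x else edge_line e x).
have px : xcoord p = x by rewrite /xcoord mxE eqxx.
have py : ycoord p = edge_line e x by rewrite /ycoord mxE.
exists p; split; apply/in_open_segmentP; rewrite ?edge_lt ?px ?py //.
Qed.

Lemma below_cross e f : proper_edge e -> proper_edge f -> below sign e f ->
  cross v e f.
Proof.
move=> pe pf /and4P[ef fe lb lw]; have ov : overlap e f by rewrite /overlap ef.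
apply/crossP => //.
have := left_right_end pe pf ov.
have := lower_black_line pe pf ov lb; have := lower_white_line pe pf ov lw.
set x := left_end e f; set y := right_end e f => h1 h2 xy.
set d1 := edge_line e x - edge_line f x; set d2 := edge_line f y - edge_line e y.
have d1_gt0 : 0 < d1 by rewrite /d1; lra.
have d2_gt0 : 0 < d2 by rewrite /d2; lra.
(* The zero of the affine function that goes from [d1] to [- d2]. *)
set t := d1 / (d1 + d2).
have t_gt0 : 0 < t by rewrite /t divr_gt0 //; lra.
have t_lt1 : t < 1 by rewrite /t ltr_pdivrMr; lra.
exists ((1 - t) * x + t * y); split; [nra|nra|].
rewrite !edge_line_convex; apply/eqP; rewrite -subr_eq0; apply/eqP.
transitivity ((1 - t) * d1 - t * d2); first by rewrite /d1 /d2; ring.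
by rewrite /t; field; lra.
Qed.

Lemma cross_overlap e f : proper_edge e -> proper_edge f -> cross v e f -> overlap e f.
Proof.
move=> pe pf /(crossP pe pf)[x [x1 x2 _]]; move: (lt_trans x1 x2).
rewrite gt_max !lt_min => /andP[/andP[_ ef] /andP[fe _]].
apply/andP; split; rewrite ltnNge; apply: contraTN isT => le.
- suff : xcoord (white f.2) < xcoord (black e.1) by move=> /(lt_trans ef); rewrite ltxx.
  by apply: vertex_lt; move: pe pf; rewrite /proper_edge; lia.
- suff : xcoord (white e.2) < xcoord (black f.1) by move=> /(lt_trans fe); rewrite ltxx.
  by apply: vertex_lt; move: pe pf; rewrite /proper_edge; lia.
Qed.

Lemma lower_black_total (i k : 'I_n.+2) :
  [|| i == k, lower_black sign i k | lower_black sign k i].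
Proof.
rewrite -(inj_eq val_inj) /lower_black /=.
by case: (ltngtP i k) => //= _; case: (sign _).
Qed.

Lemma lower_white_total (i k : 'I_n.+2) :
  [|| i == k, lower_white sign i k | lower_white sign k i].
Proof.
rewrite -(inj_eq val_inj) /lower_white /=.
by case: (ltngtP i k) => //= _; case: (sign _).
Qed.

Lemma same_black_line e f : e.1 = f.1 ->
  edge_line e (left_end e f) = edge_line f (left_end e f).
Proof. by move=> ef; rewrite /left_end -ef maxxx /edge_line line_at_left ef line_at_left. Qed.

Lemma same_white_line e f : proper_edge e -> proper_edge f -> e.2 = f.2 ->
  edge_line e (right_end e f) = edge_line f (right_end e f).
Proof.
move=> pe pf ef; rewrite /right_end -ef minxx /edge_line line_at_right ?edge_lt //.
by rewrite ef line_at_right ?edge_lt.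
Qed.

(** The line of [e] is strictly higher at the left end of the common range. Were it not strictly
    lower at the right end, it would be strictly higher at every interior point, against the
    crossing. *)
Lemma black_below_cross e f : proper_edge e -> proper_edge f -> cross v e f ->
  lower_black sign f.1 e.1 -> below sign e f.
Proof.
move=> pe pf cef lb; have ov := cross_overlap pe pf cef.
have [ef fe] := andP ov; rewrite /below ef fe lb /=.
have /(crossP pe pf)[x [x1 x2]] := cef.
have [t [t0 t1 ->]] := convex_param x1 x2.
rewrite !edge_line_convex => eqx; have := lower_black_line pe pf ov lb.
case/or3P: (lower_white_total e.2 f.2) => // [/eqP/(same_white_line pe pf)|fw] h1.
  by nra.
have ov' : overlap f e by rewrite /overlap fe.
by have := lower_white_line pf pe ov' fw; rewrite right_endC => h2; nra.
Qed.

(** If the black ends agree, the lines meet at that end and at the crossing point, hence also at the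
    right end of the range; then the white ends agree too, and [e] equals [f]. *)
Lemma cross_below e f : proper_edge e -> proper_edge f -> e != f -> cross v e f ->
  crosses sign e f.
Proof.
move=> pe pf nef cef; have ov := cross_overlap pe pf cef.
have cfe : cross v f e by case: cef => p []; exists p.
case/or3P: (lower_black_total e.1 f.1) => [/eqP ef1|lb|lb].
- have /(crossP pe pf)[x [x1 x2]] := cef.
  have [t [t0 t1 ->]] := convex_param x1 x2.
  have := same_black_line ef1; rewrite !edge_line_convex => h1.
  case/or3P: (lower_white_total e.2 f.2) => [/eqP ef2|lw|lw].
  + by case/eqP: nef; apply: edge_inj; rewrite ?ef1 ?ef2.
  + by have := lower_white_line pe pf ov lw; clear ef1 => h2 h3; nra.
  + have ov' : overlap f e by rewrite /overlap andbC.
    by have := lower_white_line pf pe ov' lw; rewrite right_endC; clear ef1 => h2 h3; nra.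
- by rewrite /crosses (black_below_cross pf pe cfe lb) orbT.
- by rewrite /crosses (black_below_cross pe pf cef lb).
Qed.
End Polygon.

(** * Transfer to geometric trees: flips, order, lattice and covers *)

Section FlipOrder.
Variables (R : realType) (n : nat) (eps : 'I_n -> bool).
Variables (v : 'I_(n.*2.+2) -> 'rV[R]_2) (I J : {set 'I_n.+2}).
Hypothesis v_polygon : is_polygon v eps.
Hypothesis I_black : I \subset [set i : 'I_n.+2 | i <= n].
Hypothesis J_white : J \subset [set j : 'I_n.+2 | 1 <= j].

Local Notation s := (sign eps).
Local Notation below := (below s).
Local Notation lower := (lower s I J).
Local Notation upper := (upper s I J).
Local Notation ctree := (ctree s I J).
Local Notation tree := (tree v I J).
Implicit Types T : tree.

Lemma edges_proper e : e \in edges I J -> proper_edge e.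
Proof.
rewrite inE => /and3P[/(subsetP I_black) + /(subsetP J_white)].
by rewrite !inE /proper_edge => -> -> ->.
Qed.

Lemma noncrossingP (S : {set edge n}) : S \subset edges I J ->
  reflect {in S &, forall e f, ~~ below e f} `[< noncrossing v S >].
Proof.
move=> /subsetP SE; apply: (iffP (asboolP _)) => [nS e f eS fS|nS e f eS fS ef cef].
  apply/negP => ef; apply: (nS e f eS fS).
    by apply: contraTneq ef => ->; rewrite belowxx.
  by apply: (below_cross v_polygon) => //; apply/edges_proper/SE.
have /orP[] : crosses s e f.
  by apply: (cross_below v_polygon) cef => //; apply/edges_proper/SE.
all: by rewrite (negPf (nS _ _ _ _)).
Qed.

Lemma is_tree_ctree (S : {set edge n}) : is_tree v I J S = ctree S.
Proof.
apply/maxsetP/ctreeP => [[/andP[SE /(noncrossingP SE) nS] Sm]|[SE nS Sm]].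
  split=> // g gE gl gu; suff <- : g |: S = S by rewrite setU11.
  have gSE : g |: S \subset edges I J by rewrite subUset sub1set gE.
  apply: Sm; rewrite ?subsetUr // gSE /=; apply/(noncrossingP gSE).
  by move=> e f /setU1P[->|eS] /setU1P[->|fS]; rewrite ?belowxx ?gl ?gu ?nS.
split; first by rewrite SE; apply/noncrossingP.
move=> S' /andP[SE' /(noncrossingP SE') nS'] /subsetP SS'.
apply/eqP; rewrite eqEsubset andbC; apply/andP; split; apply/subsetP => // g gS'.
by apply: Sm => [|t /SS' tS'|t /SS' tS']; [apply: (subsetP SE')|apply: nS'|apply: nS'].
Qed.

Lemma tree_ctree T : ctree (val T).
Proof. by rewrite -is_tree_ctree (valP T). Qed.

Definition mk_tree (S : {set edge n}) (tS : ctree S) : tree :=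
  Sub S (etrans (is_tree_ctree S) tS).

Lemma exchange_neq (S : {set edge n}) e x : exchangeable s I J S e x -> below e x ->
  x |: S :\ e != S.
Proof.
case=> eS _ _ ex; apply/eqP => /setP/(_ e); rewrite !inE eqxx eS orbF => /eqP eqex.
by move: ex; rewrite eqex belowxx.
Qed.

(** In a flip, the new edge must cross the removed one, since otherwise it could be added to [T];
    the slopes decide which of the two is below the other. *)
Lemma increasing_flipP T T' : reflect
  (exists e x, [/\ exchangeable s I J (val T) e x, below e x &
                   val T' = x |: val T :\ e])
  (increasing_flip T T').
Proof.
have [TE Tn Tm] := ctreeP _ _ _ _ (tree_ctree T).
have [TE' Tn' _] := ctreeP _ _ _ _ (tree_ctree T').
apply: (iffP andP) => [[_ /exists_inP[e eT /exists_inP[x xT' /andP[/eqP eqTT' sl]]]]|].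
  have xE := subsetP TE' _ xT'.
  have xT : {in val T, forall t, t != e -> ~~ crosses s t x}.
    move=> t tT te; have /setD1P[_ tT'] : t \in val T' :\ x.
      by rewrite -eqTT' in_setD1 te.
    by rewrite negb_or !Tn'.
  have ex : below e x.
    have neqex : x != e by apply: contraTneq sl => ->; rewrite ltxx.
    have nxT : x \notin val T.
      have : x \notin val T :\ e by rewrite eqTT' setD11.
      by rewrite in_setD1 neqex.
    have nxe : ~~ below x e.
      apply/negP => /(below_slope v_polygon).
      move=> /(_ (edges_proper xE) (edges_proper (subsetP TE _ eT))).
      by rewrite ltNge (ltW sl).
    apply: contraNT nxT => nex; apply: Tm => // t tT; have [->//|te] := eqVneq t e;
      by have := xT t tT te; rewrite negb_or => /andP[].
  by exists e, x; split=> //; rewrite eqTT' setD1K.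
case=> e [x [Hx ex eqT']]; have [eT xE xT] := Hx; split.
  by rewrite -val_eqE eqT' eq_sym exchange_neq.
apply/exists_inP; exists e => //; apply/exists_inP; exists x.
  by rewrite eqT' setU11.
apply/andP; split; last first.
  by apply: (below_slope v_polygon) => //; apply: edges_proper => //; apply: (subsetP TE).
rewrite eqT' setU1K // in_setD1 negb_and; apply/orP; right.
by apply: contraL ex => xT1; apply: Tn.
Qed.

(** Every flip enlarges [lower]. Conversely, an exchange that stays below [T'] is a flip that
    strictly enlarges [lower (val T)], so induction on the difference of the cardinals builds the
    path. *)
Lemma flip_leE T T' : flip_le T T' = (lower (val T) \subset lower (val T')).
Proof.
apply/idP/idP => [/connectP[p]|].
  elim: p T => [|T1 p IHp] T /= => [_ ->//|/andP[/increasing_flipP]].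
  case=> e [x [Hx ex eqT1]] pp /(IHp _ pp); apply: subset_trans.
  by rewrite eqT1; apply: exchange_le => //; apply: tree_ctree.
have [k] := ubnP (#|lower (val T')| - #|lower (val T)|).
elim: k T => // k IHk T; rewrite ltnS => lek leTT'.
have [->|neqT] := eqVneq T T'; first exact: connect0.
have [e [x [Hx ex le2]]] :=
  exchange_between (tree_ctree T) (tree_ctree T') neqT leTT'.
have t2 := exchange_tree (tree_ctree T) Hx ex.
apply: (@connect_trans _ _ (mk_tree t2)).
  by apply/connect1/increasing_flipP; exists e, x.
apply: IHk => //; apply: leq_trans lek.
have ltc : #|lower (val T)| < #|lower (x |: val T :\ e)|.
  apply: proper_card; rewrite properEneq exchange_le ?tree_ctree // andbT.
  apply: contra_neq (exchange_neq Hx ex) => eql.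
  exact/esym/(lower_inj (tree_ctree T) t2).
by apply: ltn_sub2l => //; apply: leq_trans ltc (subset_leq_card le2).
Qed.

Lemma flip_le_anti : antisymmetric (@flip_le R n v I J).
Proof.
move=> T T'; rewrite !flip_leE -eqEsubset => /eqP eqT.
exact/val_inj/(lower_inj (tree_ctree T) (tree_ctree T')).
Qed.

Lemma flip_le_lattice : is_lattice (@flip_le R n v I J).
Proof.
have treeE T : val T \subset edges I J := ctree_edges (tree_ctree T).
have treeUE T T' : val T :|: val T' \subset edges I J by rewrite subUset !treeE.
have tP (S : {set edge n}) (SE : S \subset edges I J) := tree_ofP s SE.
split.
- by move=> T; apply: connect0.
- exact: flip_le_anti.
- by move=> T T1 T2; apply: connect_trans.
(* The meet has the intersection of the two [lower] sets as its [lower] set, because [lower] turns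
   unions into intersections. *)
- exists (fun T T' => mk_tree (tP _ (treeUE T T')).1) => T T1 T2.
  by rewrite !flip_leE (tP _ (treeUE T1 T2)).2 lowerU subsetI.
(* Dually, the join is the tree whose [lower] set is [lower] of the intersection of the two [upper]
   sets. *)
- exists (fun T T' => mk_tree (tP _ (upper_edges s I J (val T :|: val T'))).1).
  move=> T T1 T2; rewrite !flip_leE (tP _ (upper_edges s I J (val T :|: val T1))).2.
  rewrite lower_upper_sub ?tree_ctree // upperU subsetI.
  by rewrite -!lower_upper_sub ?tree_ctree // !lower_upper ?tree_ctree.
Qed.

(** Below a cover [T'] of [T] there is a flip of [T], which must then be [T']. Conversely,
    [exchange_cover] leaves no tree strictly between the two ends of a flip. *)
Lemma flip_le_cover T T' :
  covered_by (@flip_le R n v I J) T T' <-> increasing_flip T T'.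
Proof.
split=> [[neqT leT Tm]|flipT].
  have [e [x [Hx ex le2]]] :=
    exchange_between (tree_ctree T) (tree_ctree T') neqT
      (etrans (esym (flip_leE T T')) leT).
  pose T2 := mk_tree (exchange_tree (tree_ctree T) Hx ex).
  have flip2 : increasing_flip T T2 by apply/increasing_flipP; exists e, x.
  have [| |<-//] := Tm T2 (connect1 flip2); first by rewrite flip_leE.
  by move/(congr1 val)/eqP; rewrite (negPf (exchange_neq Hx ex)).
split; [by case/andP: flipT|exact: connect1|move=> S].
have /increasing_flipP[e [x [Hx ex eqT']]] := flipT.
rewrite !flip_leE eqT' => TS ST'.
have [eqS|eqS] := exchange_cover (tree_ctree T) Hx ex (tree_ctree S) TS ST'.
  by left; apply: val_inj.
by right; apply: val_inj; rewrite eqT'.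
Qed.
End FlipOrder.

Theorem theorem2p6 (R : realType) (n : nat) (eps : 'I_n -> bool)
    (v : 'I_(n.*2.+2) -> 'rV[R]_2) (I J : {set 'I_n.+2})
    (n_ge1 : 1 <= n) (v_polygon : is_polygon v eps)
    (I_black : I \subset [set i : 'I_n.+2 | i <= n])
    (J_white : J \subset [set j : 'I_n.+2 | 1 <= j])
    (I_neq0 : I != set0) (J_neq0 : J != set0)
    (min_IJ : min_index I < min_index J)
    (max_IJ : max_index I < max_index J) :
  is_lattice (@flip_le R n v I J) /\
  (forall T T' : tree v I J,
     covered_by (@flip_le R n v I J) T T' <-> increasing_flip T T').
Proof.
split; first exact: flip_le_lattice v_polygon I_black J_white.
exact: flip_le_cover v_polygon I_black J_white.
Qed.
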